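(* Let $\psi\colon[0,\infty)\to\mathbb{R}$ and define $$g(s)=\psi\left(\operatorname{arcosh}\frac{s}{2}\right)\qquad\text{for all } s\geq 2.$$ Assume that there exists a convex and non-decreasing function $\bar g\colon[0,\infty)\to\mathbb{R}$ such that $\bar g=g$ on $[2,\infty)$. Define $$W_\psi(F)=\sum_{i=1}^3\psi\left(|\log\lambda_i|\right)\qquad\text{for all } F\in\mathrm{SL}(3),$$ where $\lambda_i=\nu_i(F)$, and $$P\colon\mathbb{R}^{3\times3}\times\mathbb{R}^{3\times3}\times(0,\infty)\to\mathbb{R},\qquad P(X,Y,d)=\sum_{i=1}^3\bar g\left(\nu_i(X+Y)\right).$$ Then $W_\psi$ is the restriction to $\mathrm{SL}(3)$ of the polyconvex function given by $P$; that is, $P$ is convex and $W_\psi(F)=P(F,\operatorname{Cof}F,\det F)$ for all $F\in\mathrm{SL}(3)$. In particular, $W_\psi$ is rank-one convex on $\mathrm{SL}(3)$.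
   Context: For a matrix $X\in\mathbb{R}^{3\times3}$, $\nu_1(X),\nu_2(X),\nu_3(X)\ge 0$ denote its singular values, counted with multiplicity. For invertible $F$, $\operatorname{Cof}F=(\det F)F^{-T}$. $\mathrm{GL}^+(3)$ is the set of real $3\times3$ matrices with positive determinant and $\mathrm{SL}(3)$ the set of real $3\times 3$ matrices with determinant $1$. $\operatorname{arcosh}\colon[1,\infty)\to[0,\infty)$ is the inverse of $\cosh$ on $[0,\infty)$. A function $F\mapsto W(F)$ on $\mathrm{GL}^+(3)$ is polyconvex if there is a convex function $P\colon\mathbb{R}^{3\times3}\times\mathbb{R}^{3\times3}\times(0,\infty)\to\mathbb{R}$ with $W(F)=P(F,\operatorname{Cof}F,\det F)$ for all $F$. A function $W\colon\mathrm{SL}(3)\to\mathbb{R}$ is rank-one convex on $\mathrm{SL}(3)$ if, for all $F\in\mathrm{SL}(3)$ and $a,b\in\mathbb{R}^3$ such that $F_t=F+t\,a\otimes b\in\mathrm{SL}(3)$ for all $t\in[0,1]$, the function $t\mapsto W(F_t)$ is convex on $[0,1]$. Here $a\otimes b=ab^T$. *)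

(* Defs.v *)
From HB Require Import structures.
From mathcomp Require Import all_boot all_order all_algebra.
From mathcomp Require Import spectral sesquilinear.
From mathcomp.real_closed Require Import complex.
From mathcomp Require Import all_classical all_reals all_analysis.
From mathcomp Require Import ring lra.

Set Implicit Arguments.
Unset Strict Implicit.
Unset Printing Implicit Defensive.

Import Order.TTheory GRing.Theory Num.Theory.

Local Open Scope classical_set_scope.
Local Open Scope ring_scope.

Definition cosh (R : realType) (x : R) : R := (expR x + expR (- x)) / 2.

(* Same style as [acos] in trigo.v: for [x < 1] the value is an irrelevant
   default. *)
Definition arcosh (R : realType) (x : R) : R :=
  get [set y | 0 <= y /\ cosh y = x].

Lemma arcosh_def (R : realType) (x : R) :
  1 <= x -> 0 <= arcosh x /\ cosh (arcosh x) = x.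
Proof.
move=> x1; rewrite /arcosh; case: xgetP => [y -> //|] /=.
set r := Num.sqrt (x ^+ 2 - 1).
have r2 : r ^+ 2 = x ^+ 2 - 1 by rewrite sqr_sqrtr// subr_ge0 exprn_ege1.
have r0 : 0 <= r := sqrtr_ge0 _.
have xr1 : 1 <= x + r by lra.
have xr0 : 0 < x + r by lra.
move/(_ (ln (x + r))); case; split; first exact: ln_ge0.
rewrite /cosh expRN lnK ?posrE//.
have -> : (x + r)^-1 = x - r.
  apply: (mulfI (lt0r_neq0 xr0)); rewrite divff ?lt0r_neq0//.
  by rewrite mulrC -subr_sqr r2; ring.
by lra.
Qed.

(* [s] lists the square roots of the eigenvalues of [X^T X] in non-increasing
   order, each repeated according to its multiplicity as a root of the
   characteristic polynomial. *)
Definition is_singular_values (R : realType) n (X : 'M[R]_n) (s : n.-tuple R) :=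
  [/\ sorted >=%R s, all (>= 0) s &
      char_poly (X^T *m X) = \prod_(x <- s) ('X - (x ^+ 2)%:P)].

Lemma gram_eigenvalue_ge0 (R : realType) n (X : 'M[R]_n) (a : R) :
  root (char_poly (X^T *m X)) a -> 0 <= a.
Proof.
rewrite -eigenvalue_root_char => /eigenvalueP[v vE v0].
have sq m (w : 'rV[R]_m) : (w *m w^T) 0 0 = \sum_j w 0 j ^+ 2.
  by rewrite mxE; apply: eq_bigr => j _; rewrite mxE expr2.
have sq0 m (w : 'rV[R]_m) : 0 <= (w *m w^T) 0 0.
  by rewrite sq sumr_ge0// => j _; exact: sqr_ge0.
have vv : 0 < (v *m v^T) 0 0.
  rewrite lt_def sq0 andbT sq; apply: contra v0 => /eqP h.
  apply/eqP/rowP => j; rewrite mxE; apply/eqP; rewrite -sqrf_eq0; apply/eqP.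
  by apply: (psumr_eq0P _ h) => // i _; exact: sqr_ge0.
have := sq0 _ (v *m X^T).
by rewrite trmx_mul trmxK mulmxA -(mulmxA v) vE -scalemxAl mxE pmulr_lge0.
Qed.

Lemma symmetric_char_poly_split (R : realType) n (A : 'M[R]_n) : A^T = A ->
  exists d : 'I_n -> R, char_poly A = \prod_i ('X - (d i)%:P).
Proof.
move=> As; pose f := @real_complex_def R (Phant R).
pose B := map_mx f A.
have Bh : B \is hermsymmx.
  apply/is_hermitianmxP; rewrite expr0 scale1r; apply/matrixP => i j.
  rewrite !mxE -[in LHS]As mxE; apply/esym/CrealP.
  by apply/complex_realP; exists (A j i).
have /orthomx_spectralP BE := hermitian_normalmx Bh.
have dr := hermitian_spectral_diag_real Bh.
have dE j : f (complex.Re (spectral_diag B 0 j)) = spectral_diag B 0 j.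
  by have /mxOverP/(_ 0 j)/complex_realP[k ->] := dr.
exists (fun j => complex.Re (spectral_diag B 0 j)).
apply: (map_poly_inj f); rewrite rmorph_prod /= map_char_poly -/B.
rewrite [in LHS]BE; have u := spectral_unit B.
have u' : map_mx polyC (spectralmx B) \in unitmx.
  by rewrite unitmxE det_map_mx rmorph_unit// -unitmxE.
have -> : char_poly (invmx (spectralmx B) *m diag_mx (spectral_diag B) *m
    spectralmx B) = char_poly (diag_mx (spectral_diag B)).
  rewrite /char_poly; set D := diag_mx _.
  have -> : char_poly_mx (invmx (spectralmx B) *m D *m spectralmx B) =
      invmx (map_mx polyC (spectralmx B)) *m char_poly_mx D *m
        map_mx polyC (spectralmx B).
    rewrite /char_poly_mx mulmxBr mulmxBl !map_mxM /=.
    congr (_ - _).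
      by rewrite -mulmxA -scalar_mxC mulKmx.
    congr (_ *m _ *m _); apply: (can_inj (mulKmx u')).
    by rewrite -map_mxM mulmxV// map_mx1 mulmxV.
  rewrite !det_mulmx mulrAC -det_mulmx mulVmx// det1 mul1r //.
rewrite char_poly_trig ?diag_mx_is_trig//.
apply: eq_bigr => j _; rewrite /= rmorphB /= map_polyX map_polyC /= -/f dE.
by rewrite !mxE eqxx mulr1n.
Qed.

Lemma singular_values_exist (R : realType) n (X : 'M[R]_n) :
  exists s : n.-tuple R, is_singular_values X s.
Proof.
have [|d dE] := @symmetric_char_poly_split R n (X^T *m X).
  by rewrite trmx_mul trmxK.
have d0 i : 0 <= d i.
  apply: (@gram_eigenvalue_ge0 _ _ X).
  by rewrite dE rootE horner_prod (bigD1 i)//= hornerXsubC subrr mul0r.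
pose t : n.-tuple R := [tuple of sort >=%R [tuple Num.sqrt (d i) | i < n]].
have tP : perm_eq t [tuple Num.sqrt (d i) | i < n] by rewrite perm_sort.
exists t; split.
- by apply: sort_sorted => x y; exact: le_total.
- rewrite (perm_all _ tP); apply/allP => x /mapP[i _ ->]; exact: sqrtr_ge0.
- rewrite (perm_big _ tP) dE big_map /= big_enum /=.
  by apply: eq_bigr => i _; rewrite sqr_sqrtr.
Qed.

Definition singular_values (R : realType) n (X : 'M[R]_n) : n.-tuple R :=
  sval (cid (singular_values_exist X)).

Definition singular_value (R : realType) n (X : 'M[R]_n) (i : 'I_n) : R :=
  tnth (singular_values X) i.

Lemma singular_valuesP (R : realType) n (X : 'M[R]_n) :
  is_singular_values X (singular_values X).
Proof. exact: (svalP (cid (singular_values_exist X))). Qed.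

Definition GLpos (R : realType) : set 'M[R]_3 := [set F | 0 < \det F].

Definition SL (R : realType) : set 'M[R]_3 := [set F | \det F = 1].

Definition Cof (R : realType) (F : 'M[R]_3) : 'M[R]_3 :=
  \det F *: (invmx F)^T.

(* Functions on a proper subset of a type are total functions whose values
   outside the subset are never looked at; [minors_domain] is
   R^(3x3) x R^(3x3) x (0, +oo). *)
Definition minors_domain (R : realType) : set ('M[R]_3 * 'M[R]_3 * R) :=
  [set x | 0 < x.2].

Definition polyconvex (R : realType) (W : 'M[R]_3 -> R) : Prop :=
  exists P : 'M[R]_3 * 'M[R]_3 * R -> R,
    convex_function (@minors_domain R) P /\
    forall F, GLpos F -> W F = P (F, Cof F, \det F).

Definition rank_one_convex_SL (R : realType) (W : 'M[R]_3 -> R) : Prop :=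
  forall (F : 'M[R]_3) (a b : 'cV[R]_3),
    SL F ->
    (forall t : R, 0 <= t <= 1 -> SL (F + t *: (a *m b^T))) ->
    convex_function (`[0, 1]%classic : set R^o)
      (fun t => W (F + t *: (a *m b^T))).

Definition W_psi (R : realType) (psi : R -> R) (F : 'M[R]_3) : R :=
  \sum_(i < 3) psi `|ln (singular_value F i)|.

Definition P_gbar (R : realType) (gbar : R -> R) (x : 'M[R]_3 * 'M[R]_3 * R) : R :=
  \sum_(i < 3) gbar (singular_value (x.1.1 + x.1.2) i).

(* Main.v *)
Require Import Defs.
From HB Require Import structures.
From mathcomp Require Import all_boot all_order all_algebra.
From mathcomp Require Import all_classical all_reals all_analysis.
From mathcomp Require Import ring lra.

Set Implicit Arguments.
Unset Strict Implicit.
Unset Printing Implicit Defensive.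

Import Order.TTheory GRing.Theory Num.Theory.

Local Open Scope classical_set_scope.
Local Open Scope ring_scope.

(** Convexity of [X |-> \sum_i phi (nu_i X)], for [phi] convex and
    non-decreasing: write the convex combination [Z] of [X] and [Y] as
    [U^T *m diag_mx s *m V].  The singular values of [Z] are the diagonal entries
    of [U *m Z *m V^T], hence convex combinations of those of [U *m X *m V^T] and
    [U *m Y *m V^T]; and by AM-GM the diagonal entries of [U *m X *m V^T] are
    bounded in absolute value by doubly stochastic averages of the singular
    values of [X], so Jensen's inequality applies.

    For [det F = 1], [Cof F = F^-T] has the singular vectors of [F], so that
    [F + Cof F] has singular values [s + s^-1 = 2 cosh |ln s|].  Along a
    rank-one segment inside SL(3), [Cof] is affine (the quadratic term of the
    inverse vanishes since [b^T F^-1 a = 0]), hence so is [F + Cof F]. *)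

(** * Unit row vectors, reflections and the singular value decomposition *)

Lemma mulmx_tr_sum (R : realType) n (v : 'rV[R]_n) :
  v *m v^T = (\sum_j v 0 j ^+ 2)%:M.
Proof.
apply/matrixP => i j; rewrite !ord1 !mxE eqxx mulr1n.
by apply: eq_bigr => k _; rewrite mxE expr2.
Qed.

Lemma mulmx_tr_eq0 (R : realType) n (v : 'rV[R]_n) : v *m v^T = 0 -> v = 0.
Proof.
move=> /matrixP/(_ 0 0); rewrite mulmx_tr_sum !mxE eqxx mulr1n => h.
apply/rowP => j; rewrite mxE; apply/eqP; rewrite -sqrf_eq0; apply/eqP.
by apply: (psumr_eq0P _ h) => // i _; exact: sqr_ge0.
Qed.

Lemma exists_unit_multiple (R : realType) n (v : 'rV[R]_n) : v != 0 ->
  exists c : R, (c *: v) *m (c *: v)^T = 1%:M.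
Proof.
move=> v0; set q := \sum_j v 0 j ^+ 2.
have q0 : 0 <= q by apply: sumr_ge0 => j _; exact: sqr_ge0.
have qn0 : q != 0.
  apply: contra_neq v0 => h; apply: mulmx_tr_eq0.
  by rewrite mulmx_tr_sum -/q h raddf0.
exists (Num.sqrt q)^-1.
rewrite linearZ /= -scalemxAr -scalemxAl scalerA mulmx_tr_sum -/q scale_scalar_mx.
by rewrite -invfM -expr2 sqr_sqrtr// mulVf.
Qed.

(* [H] is the Householder reflection exchanging [v] and the first basis vector. *)
Lemma exists_orthogonal_row0 (R : realType) n (v : 'rV[R]_n.+1) :
  v *m v^T = 1%:M ->
  exists H : 'M[R]_n.+1, H *m H^T = 1%:M /\ row 0 H = v.
Proof.
move=> vv; pose e : 'rV[R]_n.+1 := row 0 1%:M.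
have ee : e *m e^T = 1%:M.
  by apply/matrixP => i j; rewrite !ord1 /e -row_mul mul1mx !mxE.
have [->|ve] := eqVneq v e; first by exists 1%:M; rewrite trmx1 mulmx1.
pose c := v 0 0.
have ev : e *m v^T = c%:M.
  by apply/matrixP => i j; rewrite !ord1 /e -row_mul mul1mx !mxE eqxx mulr1n.
have ve1 : v *m e^T = c%:M by rewrite -[LHS]trmxK trmx_mul trmxK ev tr_scalar_mx.
have [w wE] : exists w, w = v - e by exists (v - e).
have ww : w *m w^T = (2 - 2 * c)%:M.
  rewrite wE raddfB /= mulmxBl !mulmxBr vv ve1 ev ee -!raddfB /=.
  by congr (_%:M); ring.
have c1 : 2 - 2 * c != 0.
  apply: contra_neq ve => h; apply/eqP; rewrite -subr_eq0; apply/eqP.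
  by apply: mulmx_tr_eq0; rewrite -wE ww h raddf0.
(* [2 - 2 * c] is the squared norm of [w = v - e], so [k] is the coefficient of the reflection along
   [w]. *)
pose k := 2 / (2 - 2 * c).
exists (1%:M - k *: (w^T *m w)); split.
  rewrite [(_ - _)^T]raddfB /= trmx1 [(_ *: _)^T]linearZ /= trmx_mul trmxK.
  rewrite mulmxBl !mulmxBr !mul1mx mulmx1 -scalemxAr -scalemxAl mulmxA.
  rewrite -(mulmxA _ w) ww mul_mx_scalar -scalemxAl !scalerA.
  rewrite -[LHS]addrA -[RHS]addr0; congr (_ + _).
  rewrite opprB addrCA -opprD -scalerDl -scalerBl; apply/eqP.
  rewrite scaler_eq0; apply/orP; left; apply/eqP.
  by rewrite /k; field.
rewrite [row _ _]raddfB /= -/e [row _ (_ *: _)]linearZ /= row_mul.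
have -> : row 0 w^T = (c - 1)%:M.
  by apply/matrixP => i j; rewrite !ord1 !mxE /= wE !mxE eqxx.
rewrite mul_scalar_mx scalerA.
have -> : k * (c - 1) = -1 by rewrite /k; field.
by rewrite scaleN1r opprK wE addrC subrK.
Qed.

(** Take for [v] a unit eigenvector of [X^T *m X] with eigenvalue [a], put [s = Num.sqrt a], and
    normalise [v *m X^T] to get [u]. *)
Lemma exists_singular_pair (R : realType) n (X : 'M[R]_n.+1) :
  exists (s : R) (u v : 'rV[R]_n.+1),
    [/\ 0 <= s, u *m u^T = 1%:M, v *m v^T = 1%:M,
        u *m X = s *: v & v *m X^T = s *: u].
Proof.
have [|d dE] := @symmetric_char_poly_split R _ (X^T *m X).
  by rewrite trmx_mul trmxK.
have ra : root (char_poly (X^T *m X)) (d 0).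
  by rewrite dE rootE horner_prod (bigD1 0)//= hornerXsubC subrr mul0r.
have a0 := gram_eigenvalue_ge0 ra.
move: (d 0) ra a0 => a; rewrite -eigenvalue_root_char =>
  /eigenvalueP[v0 v0E v00] a0.
have [c vv] := exists_unit_multiple v00.
have := congr1 ( *:%R c) v0E.
rewrite scalemxAl mulmxA scalerA mulrC -scalerA.
move: (c *: v0) vv => v vv vE.
have gramE : (v *m X^T) *m (v *m X^T)^T = a%:M.
  by rewrite trmx_mul trmxK mulmxA vE -scalemxAl vv scalemx1.
(* For [a = 0] division by [s] is impossible. Here [v *m X^T = 0] makes [X] singular, and any unit
   vector of its left kernel serves as [u]. *)
have [a0'|an0] := eqVneq a 0.
  have vX0 : v *m X^T = 0 by apply: mulmx_tr_eq0; rewrite gramE a0' raddf0.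
  have /rowV0Pn[u0 /sub_kermxP u0X u0n0] : kermx X != 0.
    rewrite kermx_eq0 row_free_unit -unitmx_tr -row_free_unit -kermx_eq0.
    apply/rowV0Pn; exists v; first exact/sub_kermxP.
    apply/eqP => v_eq0; move/matrixP/(_ 0 0): vv.
    by rewrite v_eq0 mul0mx !mxE eqxx => /esym/eqP; rewrite oner_eq0.
  have [k uu] := exists_unit_multiple u0n0.
  by exists 0, (k *: u0), v; split; rewrite ?scale0r // -[LHS]scalemxAl u0X scaler0.
pose s := Num.sqrt a.
have s0 : s != 0 by rewrite gt_eqF// sqrtr_gt0 lt_def an0.
have ssE : s * s = a by rewrite -expr2 sqr_sqrtr.
exists s, (s^-1 *: (v *m X^T)), v; split => //; first exact: sqrtr_ge0.
- rewrite linearZ /= -scalemxAr -scalemxAl gramE scalerA scale_scalar_mx -ssE.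
  by congr (_%:M); field.
- by rewrite -scalemxAl vE scalerA -ssE mulKf.
- by rewrite scalerA divff// scale1r.
Qed.

Lemma orthogonal_block1 (R : realType) n (U : 'M[R]_n) : U *m U^T = 1%:M ->
  (block_mx 1%:M 0 0 U : 'M[R]_(1 + n)) *m (block_mx 1%:M 0 0 U)^T = 1%:M.
Proof.
move=> UU; rewrite tr_block_mx mulmx_block.
by rewrite !(trmx1,trmx0,mul0mx,mulmx0,mul1mx,addr0,add0r) UU -scalar_mx_block.
Qed.

(** Deflation by induction on the size: if [H] and [K] are orthogonal with first rows [u] and [v], a
    singular pair for [s], then [H *m X *m K^T] has first row and column zero except for the corner
    [s], and the remaining block is smaller. *)
Lemma exists_svd (R : realType) n (X : 'M[R]_n) :
  exists (U V : 'M[R]_n) (s : 'rV[R]_n),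
    [/\ U *m U^T = 1%:M, V *m V^T = 1%:M, forall i, 0 <= s 0 i &
        X = U^T *m diag_mx s *m V].
Proof.
elim: n X => [|n IH] X.
  by exists 1%:M, 1%:M, 0; split; rewrite ?[X]flatmx0 ?flatmx0//; case.
have [s [u [v [s0 uu vv uX vX]]]] := exists_singular_pair X.
have [H [HH Hu]] := exists_orthogonal_row0 uu.
have [K [KK Kv]] := exists_orthogonal_row0 vv.
have HH' := mulmx1C HH; have KK' := mulmx1C KK.
pose M : 'M[R]_(1 + n) := H *m X *m K^T.
have XE : X = H^T *m M *m K.
  by rewrite /M !mulmxA HH' mul1mx -!mulmxA KK' mulmx1.
have Mr : row 0 M = s *: row 0 (1%:M : 'M[R]_(1 + n)).
  by rewrite /M !row_mul Hu uX -scalemxAl -KK row_mul Kv.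
have Mc : row 0 M^T = s *: row 0 (1%:M : 'M[R]_(1 + n)).
  by rewrite /M !trmx_mul trmxK mulmxA !row_mul Kv vX -scalemxAl -HH row_mul Hu.
clearbody M.
have ME : M = block_mx s%:M 0 0 (drsubmx M).
  rewrite -[LHS]submxK; congr block_mx.
  - apply/matrixP => i j; move/rowP/(_ (lshift n j)): Mr.
    by rewrite !ord1 !mxE /= lshift0 mulr1.
  - apply/matrixP => i j; move/rowP/(_ (rshift 1 j)): Mr.
    by rewrite !ord1 !mxE /= lshift0 mulr0.
  - apply/matrixP => i j; move/rowP/(_ (rshift 1 i)): Mc.
    by rewrite !ord1 !mxE /= lshift0 mulr0.
have [U [V [d [UU VV d0 DE]]]] := IH (drsubmx M).
exists ((block_mx 1%:M 0 0 U : 'M[R]_(1 + n)) *m H),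
  ((block_mx 1%:M 0 0 V : 'M[R]_(1 + n)) *m K), (row_mx s%:M d : 'rV[R]_(1 + n)).
split.
- rewrite trmx_mul mulmxA -(mulmxA _ H) HH mulmx1.
  exact: orthogonal_block1.
- rewrite trmx_mul mulmxA -(mulmxA _ K) KK mulmx1.
  exact: orthogonal_block1.
- move=> i; rewrite !mxE; case: (@splitP 1 n i) => j _; last exact: d0.
  by rewrite !ord1 mxE.
- have MD : M = (block_mx 1%:M 0 0 U)^T *m diag_mx (row_mx s%:M d) *m
      block_mx 1%:M 0 0 V.
    rewrite ME {1}DE tr_block_mx diag_mx_row !mulmx_block.
    rewrite !(trmx1,trmx0,mul0mx,mulmx0,mul1mx,mulmx1,addr0,add0r).
    by congr block_mx; apply/matrixP => i j; rewrite !ord1 !mxE.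
  by rewrite XE {1}MD trmx_mul !mulmxA.
Qed.

(** * Reading the singular values off a decomposition *)

Lemma char_poly_orthogonal_conj (R : realType) n (V A : 'M[R]_n) :
  V *m V^T = 1%:M -> char_poly (V^T *m A *m V) = char_poly A.
Proof.
move=> VV; pose W := map_mx polyC V.
have WW : W *m W^T = 1%:M by rewrite map_trmx -map_mxM VV map_mx1.
have WW' := mulmx1C WW.
have -> : char_poly (V^T *m A *m V) = \det (W^T *m char_poly_mx A *m W).
  rewrite /char_poly /char_poly_mx mulmxBr mulmxBl; congr (\det (_ - _)).
    by rewrite mul_mx_scalar -scalemxAl WW' scalemx1.
  by rewrite !map_mxM /= -map_trmx.
by rewrite !det_mulmx mulrC mulrA -det_mulmx WW det1 mul1r.
Qed.

(** The squares of both families are the roots of the characteristic polynomial of [X^T *m X], so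
    they agree up to order; nonnegativity allows taking square roots, and a sum ignores the
    order. *)
Lemma sum_singular_value (R : realType) n (U V : 'M[R]_n) (s : 'rV[R]_n)
    (phi : R -> R) :
  U *m U^T = 1%:M -> V *m V^T = 1%:M -> (forall i, 0 <= s 0 i) ->
  \sum_i phi (singular_value (U^T *m diag_mx s *m V) i) = \sum_i phi (s 0 i).
Proof.
move=> UU VV s0; set X := _ *m V.
have [_ sv0 svE] := singular_valuesP X.
have gramE : X^T *m X = V^T *m diag_mx (\row_j (s 0 j ^+ 2)) *m V.
  rewrite /X !trmx_mul trmxK tr_diag_mx !mulmxA -(mulmxA _ U) UU mulmx1.
  by rewrite -(mulmxA _ (diag_mx s) (diag_mx s)) mulmx_diag.
pose t : n.-tuple R := [tuple s 0 i | i < n].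
pose sqr (x : R) := x ^+ 2.
have sqrE : perm_eq (map sqr (singular_values X)) (map sqr t).
  apply: prod_XsubC_eq; rewrite big_map -svE gramE big_map big_tuple.
  rewrite char_poly_orthogonal_conj// char_poly_trig ?diag_mx_is_trig//.
  by apply: eq_bigr => i _; rewrite !mxE eqxx mulr1n tnth_mktuple.
have sqrK (r : n.-tuple R) : all (>= 0) r -> map Num.sqrt (map sqr r) = r.
  move=> /allP r0; rewrite -map_comp -[RHS]map_id; apply/eq_in_map => x /r0 x0.
  by rewrite /= sqrtr_sqr ger0_norm.
have := perm_map Num.sqrt sqrE.
rewrite !sqrK//; last by apply/allP => _ /mapP[i _ ->].
move=> svt; transitivity (\sum_(x <- singular_values X) phi x).
  by rewrite big_tuple.
by rewrite (perm_big _ svt) big_tuple; apply: eq_bigr => i _; rewrite tnth_mktuple.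
Qed.

Lemma orthogonal_row_sum (R : realType) n (P : 'M[R]_n) i : P *m P^T = 1%:M ->
  \sum_j P i j ^+ 2 = 1.
Proof.
move=> /matrixP/(_ i i); rewrite !mxE eqxx mulr1n => <-.
by apply: eq_bigr => j _; rewrite mxE expr2.
Qed.

(** * Jensen's inequality and convexity of sums over singular values *)

Section Jensen.
Variables (R : realType) (phi : R -> R).
Hypothesis phi_convex : forall x y t : R, 0 <= x -> 0 <= y -> 0 <= t <= 1 ->
  phi (t * x + (1 - t) * y) <= t * phi x + (1 - t) * phi y.

(** Leaving the weights unnormalised lets the induction hypothesis apply to the tail as it is; the
    tail mean [S / W] is then merged with the first point by two-point convexity. *)
Lemma jensen_weighted n (w x : 'I_n -> R) :
  (forall i, 0 <= w i) -> (forall i, 0 <= x i) -> 0 < \sum_i w i ->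
  (\sum_i w i) * phi ((\sum_i w i * x i) / \sum_i w i) <=
    \sum_i w i * phi (x i).
Proof.
elim: n w x => [|n IH] w x w0 x0; first by rewrite big_ord0 ltxx.
rewrite !big_ord_recl; set a := w ord0; set b := x ord0.
set W := \sum_(i < n) w _; set S := \sum_(i < n) w _ * x _.
have W0 : 0 <= W by apply: sumr_ge0.
have S0 : 0 <= S by apply: sumr_ge0 => i _; rewrite mulr_ge0.
have a0 : 0 <= a by exact: w0.
(* If the tail has total weight zero, its mean is undefined, but all its weights vanish and only the
   first point remains. *)
have [W00|Wn0] := eqVneq W 0.
  have wl0 i : w (lift ord0 i) = 0 by apply: (psumr_eq0P _ W00).
  have -> : S = 0 by apply: big1 => i _; rewrite wl0 mul0r.
  have -> : \sum_(i < n) w (lift ord0 i) * phi (x (lift ord0 i)) = 0.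
    by apply: big1 => i _; rewrite wl0 mul0r.
  by rewrite W00 !addr0 => ap; rewrite [a * b]mulrC mulfK ?gt_eqF.
move=> aW; have Wp : 0 < W by rewrite lt_def Wn0.
have := IH (fun i => w (lift ord0 i)) (fun i => x (lift ord0 i))
  (fun i => w0 _) (fun i => x0 _) Wp.
rewrite -/W -/S => {}IH; apply: (le_trans _ (lerD (lexx _) IH)).
have aWn : a + W != 0 by rewrite gt_eqF.
have -> : (a * b + S) / (a + W) =
    a / (a + W) * b + (1 - a / (a + W)) * (S / W) by field; rewrite Wn0.
have t01 : 0 <= a / (a + W) <= 1.
  by rewrite divr_ge0 ?(ltW aW)//= ler_pdivrMr// mul1r lerDl.
have := phi_convex (x0 ord0) (divr_ge0 S0 W0) t01.
rewrite -/b -(ler_pM2l aW) => /le_trans; apply.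
by rewrite le_eqVlt; apply/orP; left; apply/eqP; field.
Qed.

Lemma jensen n (w x : 'I_n -> R) :
  (forall i, 0 <= w i) -> (forall i, 0 <= x i) -> \sum_i w i = 1 ->
  phi (\sum_i w i * x i) <= \sum_i w i * phi (x i).
Proof.
move=> w0 x0 w1; have := jensen_weighted w0 x0.
by rewrite w1 ltr01 mul1r divr1 => /(_ isT).
Qed.

Hypothesis phi_mono : forall x y : R, 0 <= x -> x <= y -> phi x <= phi y.

(* The weights [(P i j ^+ 2 + Q i j ^+ 2) / 2], with [P = U *m A^T] and
   [Q = V *m B^T], form a doubly stochastic matrix. *)
Lemma sum_phi_diag_le n (U V A B : 'M[R]_n) (s : 'rV[R]_n) :
  U *m U^T = 1%:M -> V *m V^T = 1%:M -> A *m A^T = 1%:M -> B *m B^T = 1%:M ->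
  (forall i, 0 <= s 0 i) ->
  \sum_i phi `|(U *m (A^T *m diag_mx s *m B) *m V^T) i i| <=
    \sum_i phi (s 0 i).
Proof.
move=> UU VV AA BB s0; pose P := U *m A^T; pose Q := V *m B^T.
have orth (G H : 'M[R]_n) : G *m G^T = 1%:M -> H *m H^T = 1%:M ->
    (G *m H^T) *m (G *m H^T)^T = 1%:M.
  move=> GG HH; rewrite trmx_mul trmxK mulmxA -(mulmxA G) (mulmx1C HH).
  by rewrite mulmx1.
have PP : P *m P^T = 1%:M by exact: orth.
have QQ : Q *m Q^T = 1%:M by exact: orth.
have -> : U *m (A^T *m diag_mx s *m B) *m V^T = P *m diag_mx s *m Q^T.
  by rewrite /Q trmx_mul trmxK !mulmxA.
clearbody P Q; pose w i j := (P i j ^+ 2 + Q i j ^+ 2) / 2.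
have w0 i j : 0 <= w i j by rewrite divr_ge0 ?addr_ge0 ?sqr_ge0.
have wr i : \sum_j w i j = 1.
  by rewrite -mulr_suml big_split /= !orthogonal_row_sum//; field.
have wc j : \sum_i w i j = 1.
  rewrite -mulr_suml big_split /=.
  have tr (G : 'M[R]_n) : G *m G^T = 1%:M -> \sum_i G i j ^+ 2 = 1.
    move=> GG; rewrite -(@orthogonal_row_sum _ _ G^T j) ?trmxK ?(mulmx1C GG)//.
    by apply: eq_bigr => k _; rewrite mxE.
  by rewrite !tr//; field.
have leD i : `|(P *m diag_mx s *m Q^T) i i| <= \sum_j w i j * s 0 j.
  rewrite mul_mx_diag mxE; apply: (le_trans (ler_norm_sum _ _ _)).
  apply: ler_sum => j _; rewrite !mxE mulrAC normrM (ger0_norm (s0 j)).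
  apply: ler_wpM2r => //; rewrite /w.
  (* These two squares bound [P i j * Q i j] by [w i j] from above and by [- w i j] from below. *)
  have := sqr_ge0 (P i j - Q i j); have := sqr_ge0 (P i j + Q i j).
  by rewrite ler_norml sqrrB sqrrD => h1 h2; apply/andP; split; lra.
apply: (@le_trans _ _ (\sum_i \sum_j w i j * phi (s 0 j))).
  apply: ler_sum => i _; apply: le_trans (jensen _ _ _) => //.
  exact: phi_mono.
rewrite exchange_big /=; apply: ler_sum => j _.
by rewrite -mulr_suml wc mul1r.
Qed.

Lemma sum_singular_value_convex n (X Y : 'M[R]_n) (t : R) : 0 <= t <= 1 ->
  \sum_i phi (singular_value (t *: X + (1 - t) *: Y) i) <=
  t * (\sum_i phi (singular_value X i)) +
    (1 - t) * (\sum_i phi (singular_value Y i)).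
Proof.
move=> t01; have /andP[t0 t1] := t01.
set Z := _ + _.
have [U [V [s [UU VV s0 ZE]]]] := exists_svd Z.
have diag_le (G : 'M[R]_n) : \sum_i phi `|(U *m G *m V^T) i i| <=
    \sum_i phi (singular_value G i).
  have [A [B [r [AA BB r0 ->]]]] := exists_svd G.
  by rewrite (sum_singular_value phi AA BB r0) sum_phi_diag_le.
rewrite ZE (sum_singular_value phi UU VV s0).
have sE i : s 0 i = t * (U *m X *m V^T) i i + (1 - t) * (U *m Y *m V^T) i i.
  have <- : (U *m Z *m V^T) i i = s 0 i.
    rewrite ZE !mulmxA UU mul1mx -mulmxA VV mulmx1.
    by rewrite mxE eqxx mulr1n.
  by rewrite /Z mulmxDr mulmxDl -!scalemxAr -!scalemxAl !mxE.
apply: (@le_trans _ _ (t * (\sum_i phi `|(U *m X *m V^T) i i|) +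
    (1 - t) * (\sum_i phi `|(U *m Y *m V^T) i i|))); last first.
  by apply: lerD; apply: ler_wpM2l => //; rewrite subr_ge0.
rewrite !mulr_sumr -big_split /=; apply: ler_sum => i _.
(* The hypotheses on [phi] concern nonnegative arguments, while the diagonal entries may be
   negative; monotonicity allows replacing them by their absolute values before convexity is
   applied. *)
apply: le_trans (phi_convex _ _ _) => //; apply: phi_mono => //.
rewrite sE lerD// ler_wpM2l ?ler_norm// subr_ge0//.
Qed.

End Jensen.

(** * Hyperbolic cosine and its inverse *)

Lemma cosh_inj_ge0 (R : realType) (x y : R) :
  0 <= x -> 0 <= y -> cosh x = cosh y -> x = y.
Proof.
move=> x0 y0; rewrite /cosh !expRN => xy; apply: expR_inj.
have : 1 <= expR x by rewrite -expR0 ler_expR.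
have : 1 <= expR y by rewrite -expR0 ler_expR.
move: (expR x) (expR y) xy => a b ab b1 a1.
have [a0 b0] : a != 0 /\ b != 0 by split; rewrite gt_eqF//; lra.
(* Equality of the two values of [cosh], cleared of denominators. The second factor can vanish only
   for [a = b = 1], since both are at least 1. *)
have : (a - b) * (a * b - 1) = 0.
  have -> : (a - b) * (a * b - 1) =
    ((a + a^-1) / 2 - (b + b^-1) / 2) * (2 * (a * b)) by field; rewrite a0 b0.
  by rewrite ab subrr mul0r.
move/eqP; rewrite mulf_eq0 !subr_eq0 => /orP[/eqP//|/eqP ab1].
by nra.
Qed.

(** The argument of [arcosh] is [cosh (ln s)], and [cosh] is even. The lower bound keeps [arcosh]
    off its default value and places [s + s^-1] where [gbar] is given by [psi]. *)
Lemma arcosh_half_addV (R : realType) (s : R) : 0 < s ->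
  2 <= s + s^-1 /\ arcosh ((s + s^-1) / 2) = `|ln s|.
Proof.
move=> s0.
have s2 : 2 <= s + s^-1.
  rewrite -subr_ge0 (_ : _ - 2 = (s - 1) ^+ 2 / s) ?divr_ge0 ?sqr_ge0 ?ltW//.
  by field; rewrite gt_eqF.
have s1 : 1 <= (s + s^-1) / 2 by lra.
have [c0 cE] := arcosh_def s1; split => //.
apply: cosh_inj_ge0 => //; rewrite {}cE /cosh.
have [l0|l0] := lerP 0 (ln s).
  by rewrite ger0_norm// expRN lnK.
by rewrite ltr0_norm// opprK expRN lnK// addrC.
Qed.

(** * Rank-one updates: determinant and cofactor matrix *)

Lemma det_rank_one_update (R : realType) n (F : 'M[R]_n) (a b : 'cV[R]_n) :
  F \in unitmx ->
  \det (F + a *m b^T) = \det F * (1 + (b^T *m invmx F *m a) 0 0).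
Proof.
move=> Fu; set x := invmx F *m a.
have -> : F + a *m b^T = F *m (1%:M + x *m b^T).
  by rewrite mulmxDr mulmx1 /x !mulmxA mulmxV// mul1mx.
rewrite det_mulmx -mulmxA -/x; congr (_ * _).
(* Both sides factor [block_mx 1%:M (- b^T) x 1%:M] into block triangular matrices; comparing
   determinants gives the formula. *)
have : block_mx 1%:M 0 x 1%:M *m block_mx 1%:M (- b^T) 0 (1%:M + x *m b^T) =
    block_mx (1%:M + b^T *m x) (- b^T) 0 1%:M *m block_mx 1%:M 0 x 1%:M.
  rewrite !mulmx_block !(mul1mx,mulmx1,mul0mx,mulmx0,addr0,add0r).
  by rewrite mulmxN mulNmx addrK addrCA addNr addr0.
move/(congr1 determinant); rewrite !det_mulmx !det_lblock !det_ublock !det1.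
by rewrite !mul1r !mulr1 => ->; rewrite det_mx11 !mxE eqxx.
Qed.

Lemma Cof_SL_line (R : realType) (F : 'M[R]_3) (a b : 'cV[R]_3) :
  SL F -> (forall t : R, 0 <= t <= 1 -> SL (F + t *: (a *m b^T))) ->
  exists D : 'M[R]_3, forall t : R, 0 <= t <= 1 ->
    Cof (F + t *: (a *m b^T)) = Cof F + t *: D.
Proof.
move=> SF St; have Fu : F \in unitmx by rewrite unitmxE SF unitr1.
(* The endpoint [t = 1] also has determinant 1, which forces this scalar to vanish. *)
have bFa : b^T *m invmx F *m a = 0.
  have /St : 0 <= (1 : R) <= 1 by rewrite ler01 lexx.
  rewrite /SL /= scale1r det_rank_one_update// SF mul1r => h.
  by apply/matrixP => i j; rewrite !ord1 [RHS]mxE; lra.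
(* The slope comes from the Sherman-Morrison formula, whose denominator is 1 by [bFa]. *)
exists (- (invmx F *m a *m b^T *m invmx F)^T) => t /St St1.
have Ftu : F + t *: (a *m b^T) \in unitmx by rewrite unitmxE St1 unitr1.
rewrite /Cof SF St1 !scale1r scalerN -[X in _ - X]linearZ /= -[RHS]raddfB /=.
congr trmx; apply: (can_inj (mulKmx Ftu)); rewrite mulmxV//.
rewrite mulmxBr !mulmxDl mulmxV// -!scalemxAl -!scalemxAr !mulmxA mulmxV// mul1mx.
rewrite -(mulmxA a b^T) -(mulmxA a (b^T *m _)) bFa.
by rewrite mulmx0 !mul0mx !scaler0 addr0 addrK.
Qed.

(** * The energy on SL(3) and its convexity *)

Lemma W_psi_SL (R : realType) (psi gbar : R -> R) :
  (forall s, 2 <= s -> gbar s = psi (arcosh (s / 2))) ->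
  forall F : 'M[R]_3, SL F -> W_psi psi F = P_gbar gbar (F, Cof F, \det F).
Proof.
move=> gE F SF; have [U [V [s [UU VV s0 FE]]]] := exists_svd F.
have sp i : 0 < s 0 i.
  rewrite lt_def s0 andbT; apply/eqP => si.
  have : \det F != 0 by rewrite SF oner_neq0.
  by rewrite FE !det_mulmx det_diag (bigD1 i)//= si !(mul0r,mulr0) eqxx.
pose r := \row_j (s 0 j)^-1.
have invE : invmx F = V^T *m diag_mx r *m U.
  have Fu : F \in unitmx by rewrite unitmxE SF unitr1.
  apply: (can_inj (mulKmx Fu)); rewrite mulmxV// FE !mulmxA.
  rewrite -(mulmxA _ V) VV mulmx1 -(mulmxA _ (diag_mx s) (diag_mx r)) mulmx_diag.
  rewrite (_ : diag_mx _ = 1%:M) ?mulmx1 ?(mulmx1C UU)//.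
  apply/matrixP => i j; rewrite !mxE; have [->|//] := eqVneq i j.
  by rewrite divff// gt_eqF.
(* Transposing the inverse puts [U^T] back on the left and [V] on the right, so the diagonal factors
   of [F] and [Cof F] simply add. *)
rewrite /P_gbar /= /Cof SF scale1r invE !trmx_mul trmxK tr_diag_mx mulmxA.
rewrite {2}FE -mulmxDl -mulmxDr -raddfD /= /W_psi FE.
rewrite (sum_singular_value (fun x => psi `|ln x|) UU VV s0).
rewrite sum_singular_value//; last first.
  by move=> i; rewrite !mxE addr_ge0// ?invr_ge0.
apply: eq_bigr => i _; rewrite !mxE.
by have [s2 <-] := arcosh_half_addV (sp i); rewrite gE.
Qed.

Theorem theorem2p2 (R : realType) (psi g gbar : R -> R)
  (g_def : forall s : R, 2 <= s -> g s = psi (arcosh (s / 2)))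
  (gbar_convex : convex_function (`[0, +oo[%classic : set R^o) gbar)
  (gbar_nondecreasing :
    forall x y : R, 0 <= x -> x <= y -> gbar x <= gbar y)
  (gbar_g : forall s : R, 2 <= s -> gbar s = g s) :
  [/\ convex_function (@minors_domain R) (P_gbar gbar),
      polyconvex (fun F => P_gbar gbar (F, Cof F, \det F)),
      (forall F : 'M[R]_3, SL F ->
         W_psi psi F = P_gbar gbar (F, Cof F, \det F)) &
      rank_one_convex_SL (W_psi psi)].
Proof.
have gc x y t : 0 <= x -> 0 <= y -> 0 <= t <= 1 ->
    gbar (t * x + (1 - t) * y) <= t * gbar x + (1 - t) * gbar y.
  move=> x0 y0 /andP[t0 t1]; have := gbar_convex (Itv01 t0 t1) x y.
  by rewrite !inE /= !in_itv /= !andbT => /(_ x0 y0).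
have sc := sum_singular_value_convex gc gbar_nondecreasing.
(* [P_gbar] is a convex function of one matrix composed with the linear map sending a triple to the
   sum of its two matrices. *)
have PE x y (t : R) : 0 <= t <= 1 ->
    P_gbar gbar (t *: x + (1 - t) *: y) <=
    t * P_gbar gbar x + (1 - t) * P_gbar gbar y.
  move=> t01; rewrite /P_gbar; apply: le_trans (sc _ _ _ _ t01).
  by rewrite /= !scalerDr addrACA.
have Pc : convex_function (@minors_domain R) (P_gbar gbar).
  by move=> t x y _ _; apply: PE; rewrite ge0 le1.
have WE : forall F : 'M[R]_3, SL F ->
    W_psi psi F = P_gbar gbar (F, Cof F, \det F).
  by apply: W_psi_SL => s s2; rewrite gbar_g// g_def.
split => //; first by exists (P_gbar gbar).
move=> F a b SF St t x y.
have [D CofE] := Cof_SL_line SF St.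
rewrite !inE /= !in_itv /= => x01 y01.
have t01 : (0 : R) <= t%:inum <= 1 by rewrite ge0 le1.
set z : R := conv t x y.
have zE : z = t%:inum * x + (1 - t%:inum) * y by [].
have z01 : 0 <= z <= 1.
  have [[x0 x1] [y0 y1]] := (andP x01, andP y01).
  have [t0 t1] := andP t01.
  by rewrite zE; apply/andP; split; nra.
rewrite (WE _ (St _ z01)) (WE _ (St _ x01)) (WE _ (St _ y01)).
pose p (v : R) := F + v *: (a *m b^T).
(* Since [Cof] is affine along the segment, [p z + Cof (p z)] is the same convex combination of its
   values at [x] and [y], so the left side of [PE] equals the value at [z]. *)
apply: le_trans (PE (p x, Cof (p x), \det (p x))
  (p y, Cof (p y), \det (p y)) _ t01).
rewrite /P_gbar /p /= !CofE// zE le_eqVlt; apply/orP; left; apply/eqP.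
apply: eq_bigr => i _; congr (gbar (singular_value _ i)).
by apply/matrixP => j k; rewrite !mxE; ring.
Qed.
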